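(* Let $\{W_n\}_{n=1}^N$ be subspaces of $\mathbb{R}^M$ with $\dim W_n=D_n$. The following are equivalent: (a) $\{W_n\}_{n=1}^N$ allows phase retrieval for $\mathbb{R}^M$. (b) For every choice of orthonormal bases $\{\varphi_{n,d}\}_{d=1}^{D_n}$ of $W_n$, $n=1,\dots,N$, the family of vectors $\{\varphi_{n,d}\}_{n=1,\,d=1}^{N,\ D_n}$ allows phase retrieval in $\mathbb{R}^M$ (and thus has the complement property).
   Context: Given subspaces $\{W_n\}_{n=1}^N$ of $\mathbb{R}^M$ with orthogonal projections $P_n:\mathbb{R}^M\to W_n$, one says that $\{W_n\}_{n=1}^N$ allows phase retrieval in (or for) $\mathbb{R}^M$ if the map $\mathcal{A}:\mathbb{R}^M/\{\pm1\}\to\mathbb{R}^N$, $\mathcal{A}(x)(n)=\|P_nx\|^2$, is injective; that is, whenever $x,y\in\mathbb{R}^M$ satisfy $\|P_nx\|=\|P_ny\|$ for all $n$, then $x=y$ or $x=-y$. A finite family of vectors $\{\varphi_i\}_{i\in S}$ in $\mathbb{R}^M$ allows phase retrieval if whenever $x,y\in\mathbb{R}^M$ satisfy $|\langle x,\varphi_i\rangle|=|\langle y,\varphi_i\rangle|$ for all $i\in S$, then $x=y$ or $x=-y$. A finite family $\{\varphi_i\}_{i\in S}$ in $\mathbb{R}^M$ has the complement property if for every $I\subseteq S$ either $\{\varphi_i\}_{i\in I}$ or $\{\varphi_i\}_{i\in S\setminus I}$ spans $\mathbb{R}^M$. *)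

(* Defs.v *)
From HB Require Import structures.
From mathcomp Require Import all_boot all_order all_algebra.
From mathcomp Require Import reals.

Set Implicit Arguments.
Unset Strict Implicit.
Unset Printing Implicit Defensive.

Import Order.TTheory GRing.Theory Num.Theory.

Local Open Scope ring_scope.

Section InnerProduct.
Variables (R : realType) (M : nat).
Implicit Types u v : 'rV[R]_M.

Definition dotv u v : R := \sum_(i < M) u 0 i * v 0 i.

(* The Euclidean norm; mathcomp-analysis equips 'rV[R]_M with the sup norm. *)
Definition enorm u : R := Num.sqrt (dotv u u).

Fact dotv_bilinear : bilinear_for
  (GRing.Scale.Law.clone _ _ *%R _) (GRing.Scale.Law.clone _ _ (idfun \; *%R) _)
  dotv.
Proof.
split=> [v|u] a x y /=; rewrite mulr_sumr -big_split /=.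
- by apply: eq_bigr => i _; rewrite !mxE mulrDl mulrA.
- by apply: eq_bigr => i _; rewrite !mxE mulrDr mulrCA.
Qed.

HB.instance Definition _ :=
  bilinear_isBilinear.Build R 'rV[R]_M 'rV[R]_M R _ _ dotv dotv_bilinear.

Fact dotv_hermitian u v : dotv u v = (-1) ^+ false * idfun (dotv v u).
Proof. by rewrite mul1r; apply: eq_bigr => i _; rewrite mulrC. Qed.

HB.instance Definition _ :=
  isHermitianSesquilinear.Build R 'rV[R]_M false idfun dotv dotv_hermitian.

Fact dotv_gt0 u : u != 0 -> 0 < dotv u u.
Proof.
move=> u_neq0; rewrite lt_def sumr_ge0 ?andbT => [|i _]; last exact: sqr_ge0.
apply: contraNneq u_neq0 => /eqP; rewrite psumr_eq0 => [/allP u0|i _]; last first.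
  exact: sqr_ge0.
apply/eqP/rowP => i; rewrite mxE; apply/eqP.
by have := u0 i (mem_index_enum i); rewrite /= mulf_eq0 orbb.
Qed.

HB.instance Definition _ := isDotProduct.Build R 'rV[R]_M dotv dotv_gt0.

End InnerProduct.

Section Projection.
Variables (R : realType) (M : nat).
Implicit Types W : {vspace 'rV[R]_M}.

Definition orthoproj W : 'End('rV[R]_M) := daddv_pi W (orthov (@dotv R M) W).

Lemma capv_orthov W : (W :&: orthov (@dotv R M) W = 0)%VS.
Proof.
apply/eqP; rewrite -subv0; apply/subvP => x; rewrite memv_cap memv0.
case/andP => xW /mem_orthovP/(_ x xW) x0; apply/negPn/negP => /dotv_gt0.
by rewrite x0 ltxx.
Qed.

Lemma addv_orthov W : (W + orthov (@dotv R M) W)%VS = fullv.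
Proof.
pose B : 'M[R]_(M, \dim W) := \matrix_(i, j) (tnth (vbasis W) j) 0 i.
pose T : 'Hom('rV[R]_M, 'rV[R]_(\dim W)) := linfun (mulmxr B).
have kerT : (lker T <= orthov (@dotv R M) W)%VS.
  apply/subvP => x; rewrite memv_ker lfunE /= => /eqP/rowP xB.
  apply/mem_orthovP => v /coord_vbasis ->; rewrite linear_sumr big1 //= => j _.
  rewrite linearZr /= [dotv _ _](_ : _ = 0) ?mulr0 //.
  rewrite -tnth_nth; have := xB j; rewrite !mxE => <-.
  by apply: eq_bigr => i _; rewrite mxE.
apply/eqP; rewrite eqEdim subvf /= dimv_disjoint_sum ?capv_orthov //.
rewrite -(limg_ker_dim T fullv) capfv addnC leq_add ?(dimvS kerT) //.
by apply: leq_trans (dimvS (subvf _)) _; rewrite dimvf /dim /= mul1n.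
Qed.

Lemma orthoproj_mem W x : orthoproj W x \in W.
Proof. exact: memv_pi. Qed.

Lemma orthoproj_orth W x w : w \in W -> dotv (x - orthoproj W x) w = 0.
Proof.
have dW := capv_orthov W.
have xV : x \in (W + orthov (@dotv R M) W)%VS by rewrite addv_orthov memvf.
rewrite -{1}(daddv_pi_add dW xV) addrC addKr => wW.
by apply: (mem_orthovP (memv_pi _ W x)).
Qed.

End Projection.

Section PhaseRetrieval.
Variables (R : realType) (M : nat).

Definition subspaces_phase_retrieval (N : nat)
    (W : 'I_N -> {vspace 'rV[R]_M}) : Prop :=
  forall x y : 'rV[R]_M,
    (forall n, enorm (orthoproj (W n) x) = enorm (orthoproj (W n) y)) ->
    x = y \/ x = - y.

Definition vectors_phase_retrieval (S : finType) (phi : S -> 'rV[R]_M) : Prop :=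
  forall x y : 'rV[R]_M,
    (forall i, `|dotv x (phi i)| = `|dotv y (phi i)|) -> x = y \/ x = - y.

Definition complement_property (S : finType) (phi : S -> 'rV[R]_M) : Prop :=
  forall I : {set S},
    (<<[seq phi i | i in I]>> = fullv)%VS \/
    (<<[seq phi i | i in ~: I]>> = fullv)%VS.

Definition orthonormal_basis (W : {vspace 'rV[R]_M}) (s : seq 'rV[R]_M) : Prop :=
  orthonormal (@dotv R M) s /\ basis_of W s.

(* The double family (phi_{n,d}), indexed by the pairs (n, d) with d < D n. *)
Definition double_family (N : nat) (D : 'I_N -> nat)
    (phi : forall n, (D n).-tuple 'rV[R]_M) (i : {n : 'I_N & 'I_(D n)}) :
    'rV[R]_M :=
  tnth (phi (tag i)) (tagged i).

End PhaseRetrieval.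

(* Main.v *)
Require Import Defs.
From HB Require Import structures.
From mathcomp Require Import all_boot all_order all_algebra.
From mathcomp Require Import reals.

(** If s is an orthonormal basis of W_n, Parseval's identity gives
    |P_n x|^2 as the sum of the <x, v>^2 over v in s, so equal moduli of the
    coefficients in every W_n give equal norms of the projections: phase
    retrieval by the subspaces implies phase retrieval by any choice of bases.

    Conversely, let |P_n x| = |P_n y| for all n, and put a = P_n x, b = P_n y.
    As |a| = |b|, the vectors a + b and a - b are orthogonal (the diagonals of
    a rhombus), so W_n has an orthonormal basis formed by the unit vector along
    a + b, which is orthogonal to a - b, and by vectors orthogonal to a + b
    ([ex_balanced_orthonormal_basis]); if a + b = 0, any orthonormal basis will
    do. In such a basis a and b, hence x and y, have coefficients that agree up
    to sign. Phase retrieval for this one choice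
    of bases then yields x = y or x = - y.

    The complement property is the classical necessary condition. If neither
    half of the family spans, take nonzero u and v orthogonal to the two halves;
    u + v and u - v have coefficients of the same modulus, yet they are neither
    equal nor opposite ([phase_retrieval_complement]). *)

Set Implicit Arguments.
Unset Strict Implicit.
Unset Printing Implicit Defensive.

Import Order.TTheory GRing.Theory Num.Theory.

Local Open Scope ring_scope.

Section EuclideanSpace.
Variables (R : realType) (M : nat).
Implicit Types (u v w x y a b : 'rV[R]_M) (W : {vspace 'rV[R]_M}).
Implicit Types s : seq 'rV[R]_M.

Lemma dotvC u v : dotv u v = dotv v u.
Proof. by apply: eq_bigr => i _; rewrite mulrC. Qed.

Lemma dotvZl c u v : dotv (c *: u) v = c * dotv u v.
Proof. by rewrite linearZl_LR. Qed.

Lemma dotvv_ge0 u : 0 <= dotv u u.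
Proof. by apply: sumr_ge0 => i _; exact: sqr_ge0. Qed.

Lemma enorm_sqr u : enorm u ^+ 2 = dotv u u.
Proof. by rewrite sqr_sqrtr ?dotvv_ge0. Qed.

Lemma enorm_eq0 u : (enorm u == 0) = (u == 0).
Proof.
apply/idP/eqP => [|->]; last by rewrite /enorm linear0l sqrtr0.
rewrite -sqrf_eq0 enorm_sqr => u0; apply/eqP; apply: contraLR u0 => /dotv_gt0.
by rewrite lt0r => /andP[].
Qed.

Lemma notin_orthov W u : u \in W -> u != 0 -> u \notin orthov (@dotv R M) W.
Proof.
by move=> uW u0; apply/mem_orthovPn; exists u; last exact: lt0r_neq0 (dotv_gt0 u0).
Qed.

Lemma size_orthonormal_basis W s : orthonormal_basis W s -> size s = \dim W.
Proof. by case=> _ s_basis; rewrite (@size_basis _ _ _ _ (in_tuple s) s_basis). Qed.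

(** What makes orthonormal bases constructible by induction on the dimension:
    W is the orthogonal sum of the line through u and of the vectors of W
    orthogonal to u. *)
Lemma orthonormal_basis_cons W u s :
    u \in W -> u != 0 ->
    orthonormal_basis (W :&: orthov (@dotv R M) <[u]>)%VS s ->
  orthonormal_basis W ((enorm u)^-1 *: u :: s).
Proof.
move=> uW u0 s_onb; have [s_on s_basis] := s_onb.
have nu0 : enorm u != 0 by rewrite enorm_eq0.
have s_perp v : v \in s -> dotv v u = 0.
  move=> /(basis_mem s_basis); rewrite memv_cap => /andP[_].
  by rewrite mem_orthov1 => /eqP.
split.
  move: s_on; rewrite /orthonormal /= => /andP[-> ->]; rewrite !andbT.
  apply/andP; split.
    by rewrite dotvZl dotvC dotvZl -enorm_sqr expr2 mulKf // mulVf.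
  by apply/allP => v vs /=; rewrite dotvZl dotvC s_perp ?mulr0.
rewrite basisEdim; apply/andP; split; last first.
  rewrite /= (size_orthonormal_basis s_onb) -(eq_dim_orthov1 (notin_orthov uW u0)) prednK //.
  rewrite lt0n dimv_eq0; apply: contraNneq u0 => W0.
  by move: uW; rewrite W0 memv0.
apply/subvP => w wW; rewrite span_cons.
(* The coefficient dotv w u / |u|^2 makes the remainder orthogonal to u. *)
rewrite -(subrK ((dotv w u / dotv u u) *: u) w) addrC memv_add //.
  rewrite -[u in X in X \in _](scalerKV nu0) memvZ // memvZ //.
  exact: memv_line.
rewrite (span_basis s_basis) memv_cap rpredB ?memvZ //= mem_orthov1.
rewrite linearBl /= dotvZl divfK ?subrr //.
by rewrite -enorm_sqr sqrf_eq0.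
Qed.

Lemma ex_orthonormal_basis W : exists s, orthonormal_basis W s.
Proof.
have [n] := ubnP (\dim W); elim: n => // n IHn in W *; rewrite ltnS => dimW.
have [W0|] := eqVneq (\dim W) 0%N.
  by exists [::]; split=> //; rewrite basisEdim span_nil W0 subv0 -dimv_eq0 W0.
rewrite dimv_eq0 => W_neq0; pose u := vpick W.
have u0 : u != 0 by rewrite vpick0.
have uW : u \in W by exact: memv_pick.
have [|s s_onb] := IHn (W :&: orthov (@dotv R M) <[u]>)%VS.
  rewrite -(eq_dim_orthov1 (notin_orthov uW u0)); apply: leq_trans dimW.
  by rewrite ltn_predL lt0n dimv_eq0.
by exists ((enorm u)^-1 *: u :: s); exact: orthonormal_basis_cons.
Qed.

Lemma orthonormal_parseval s w :
    orthonormal (@dotv R M) s -> w \in <<s>>%VS ->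
  dotv w w = \sum_(v <- s) dotv w v ^+ 2.
Proof.
elim: s w => [|a s IHs] w.
  by rewrite span_nil memv0 => _ /eqP->; rewrite big_nil linear0l.
rewrite /orthonormal /= andbT -andbA => /and4P[/eqP a1 s1 /allP a_perp s_on].
rewrite span_cons => /memv_addP[_ /vlineP[c ->] [t ts ->]].
have at0 : dotv a t = 0.
  rewrite (coord_span (X := in_tuple s) ts) linear_sumr big1 //= => i _.
  by rewrite linearZr_LR /= (eqP (a_perp _ _)) ?mulr0 ?mem_nth.
rewrite big_cons !linearDl /= !linearDr /= ![dotv _ (c *: a)]dotvC !dotvZl.
rewrite ![dotv _ (c *: a)]dotvC !dotvZl [dotv t a]dotvC at0 a1 !mulr0 !mulr1.
rewrite addr0 add0r addr0 expr2; congr (_ + _).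
rewrite IHs //; last by rewrite /orthonormal s1.
apply: eq_big_seq => v vs.
by rewrite linearDl /= dotvZl (eqP (a_perp _ vs)) mulr0 add0r.
Qed.

(** The heart of the converse: for |a| = |b| one has
    <a, v>^2 - <b, v>^2 = <a + b, v> <a - b, v>, with a + b and a - b
    orthogonal; it suffices that each basis vector be orthogonal to one of
    the two. *)
Lemma ex_balanced_orthonormal_basis W a b :
    a \in W -> b \in W -> dotv a a = dotv b b ->
  exists2 s, orthonormal_basis W s &
    forall v, v \in s -> `|dotv a v| = `|dotv b v|.
Proof.
move=> aW bW ab_norm.
have perp_eq v : dotv (a + b) v = 0 -> `|dotv a v| = `|dotv b v|.
  by rewrite linearDl /= => /eqP; rewrite addr_eq0 => /eqP->; rewrite normrN.
have [ab0|ab0] := eqVneq (a + b) 0.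
  have [s s_onb] := ex_orthonormal_basis W.
  by exists s => // v _; apply: perp_eq; rewrite ab0 linear0l.
have [s s_onb] :=
  ex_orthonormal_basis (W :&: orthov (@dotv R M) <[a + b]>)%VS.
exists ((enorm (a + b))^-1 *: (a + b) :: s).
  by apply: orthonormal_basis_cons => //; exact: rpredD.
move=> v; rewrite inE => /predU1P[->|vs].
  rewrite ![dotv _ (_ *: _)]dotvC !dotvZl !linearDl /= ab_norm.
  by rewrite [dotv a b]dotvC [dotv b b + _]addrC.
apply: perp_eq; rewrite dotvC.
have := basis_mem s_onb.2 vs; rewrite memv_cap => /andP[_].
by rewrite mem_orthov1 => /eqP.
Qed.

Lemma dotv_orthoproj W x w : w \in W -> dotv (orthoproj W x) w = dotv x w.
Proof.
by move=> /(orthoproj_orth x)/eqP; rewrite linearBl /= subr_eq0 => /eqP.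
Qed.

Lemma orthoproj_parseval W s x :
    orthonormal_basis W s ->
  dotv (orthoproj W x) (orthoproj W x) = \sum_(v <- s) dotv x v ^+ 2.
Proof.
move=> [s_on s_basis].
rewrite (orthonormal_parseval s_on) ?(span_basis s_basis) ?orthoproj_mem //.
by apply: eq_big_seq => v /(basis_mem s_basis)/(dotv_orthoproj x)->.
Qed.

Lemma ex_orthogonal_neq0 W :
  W != fullv -> exists2 u, u != 0 & forall w, w \in W -> dotv u w = 0.
Proof.
move=> W_proper; exists (vpick (orthov (@dotv R M) W)); last first.
  by move=> w wW; apply: (mem_orthovP (memv_pick _)).
rewrite vpick0; apply: contra_neq W_proper => perp0.
by rewrite -(addv_orthov W) perp0 addv0.
Qed.

Lemma phase_retrieval_complement (S : finType) (phi : S -> 'rV[R]_M) :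
  vectors_phase_retrieval phi -> complement_property phi.
Proof.
move=> phiPR I.
have [|/ex_orthogonal_neq0[u u0 u_perp]] :=
    eqVneq <<[seq phi i | i in I]>>%VS fullv.
  by left.
have [|/ex_orthogonal_neq0[v v0 v_perp]] :=
    eqVneq <<[seq phi i | i in ~: I]>>%VS fullv.
  by right.
have double0 w : w + w = 0 -> w = 0.
  by move/eqP; rewrite -mulr2n -scaler_nat scaler_eq0 pnatr_eq0 => /eqP.
case: (phiPR (u + v) (u - v)) => [i|/addrI/eqP|/eqP].
- rewrite linearDl linearBl /=; have [iI|iI] := boolP (i \in I).
    by rewrite u_perp ?add0r ?sub0r ?normrN //; apply/memv_span/image_f.
  by rewrite v_perp ?addr0 ?subr0 //; apply/memv_span/image_f; rewrite inE.
- by rewrite -addr_eq0 => /eqP/double0/eqP; rewrite (negPf v0).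
- rewrite opprB [v - u]addrC [u + v]addrC [- u + v]addrC => /eqP/addrI/eqP.
  by rewrite -addr_eq0 => /eqP/double0/eqP; rewrite (negPf u0).
Qed.

End EuclideanSpace.

Theorem theorem3p5 (R : realType) (M N : nat) (D : 'I_N -> nat)
    (W : 'I_N -> {vspace 'rV[R]_M}) (dimW : forall n, \dim (W n) = D n) :
  (subspaces_phase_retrieval W <->
   (forall phi : forall n, (D n).-tuple 'rV[R]_M,
      (forall n, orthonormal_basis (W n) (phi n)) ->
      vectors_phase_retrieval (double_family phi))) /\
  (forall phi : forall n, (D n).-tuple 'rV[R]_M,
     (forall n, orthonormal_basis (W n) (phi n)) ->
     vectors_phase_retrieval (double_family phi) ->
     complement_property (double_family phi)).
Proof.
split; last by move=> phi _; exact: phase_retrieval_complement.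
split=> [WPR phi phi_onb x y xy|basesPR x y xy].
  apply: WPR => n; congr Num.sqrt.
  rewrite !(orthoproj_parseval _ (phi_onb n)) !big_tuple.
  apply: eq_bigr => d _.
  have /= xy_nd := xy (Tagged (fun n => 'I_(D n)) d).
  by rewrite -[LHS]real_normK ?num_real // xy_nd real_normK ?num_real.
have /fin_all_exists[phi phiP] n : exists phi : (D n).-tuple 'rV[R]_M,
    orthonormal_basis (W n) phi /\
    forall v, v \in phi -> `|dotv x v| = `|dotv y v|.
  have [|s s_onb s_bal] := @ex_balanced_orthonormal_basis R M (W n)
      (orthoproj (W n) x) (orthoproj (W n) y) (orthoproj_mem _ _)
      (orthoproj_mem _ _).
    by rewrite -!enorm_sqr xy.
  have size_s : size s == D n by rewrite -dimW (size_orthonormal_basis s_onb).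
  exists (Tuple size_s); split=> // v vs; move: (s_bal v vs).
  by rewrite !(dotv_orthoproj _ (basis_mem s_onb.2 vs)).
apply: (basesPR phi) => [n|[n d]]; first by have [] := phiP n.
by have [_] := phiP n; apply; exact: mem_tnth.
Qed.
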